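(* Let $b\in\mathbb{C}$ and set $$\hat\Psi(x,z;b)=\left(z^2-2zx+b^2-\frac{z+b}{x+b}\right)\Psi(x,z),\qquad \Psi(x,z)=\exp(xz-z^2/4).$$ Then $$\hat\Psi(x,z;b)=\sum_{n=0}^\infty \hat h_n(x;b)\,\frac{z^n}{n!}.$$
   Context: $h_n(x)=\sum_{j=0}^{\lfloor n/2\rfloor}\frac{n!}{(n-2j)!\,j!}x^{n-2j}(-4)^{-j}$, $n\in\mathbb{N}_0=\{0,1,2,\dots\}$, are the monic Hermite polynomials (they satisfy $xh_n=h_{n+1}+\frac n2h_{n-1}$, $h_0=1$). For $n\in\mathbb{N}_0$, $$\hat h_n(x;b):=(b^2-2n)h_n(x)-\frac{b\,h_n(x)+n\,h_{n-1}(x)}{x+b},$$ where the term $n\,h_{n-1}$ is $0$ when $n=0$. This is a rational function of $x$ with possible pole only at $x=-b$. *)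

(* Defs.v *)
From Stdlib Require Export Reals Factorial.
From Coquelicot Require Export Coquelicot.

Open Scope C_scope.

Definition Cexp (z : C) : C :=
  (exp (Re z) * cos (Im z), exp (Re z) * sin (Im z))%R.

(* Monic Hermite polynomials. Coquelicot's [sum_n a N] includes both endpoints
   0 and N; for j <= n/2 the subtraction n - 2j in nat is exact. *)
Definition hermite (n : nat) (x : C) : C :=
  sum_n (fun j : nat =>
           INR (fact n) / (INR (fact (n - 2 * j)) * INR (fact j))
             * x ^ (n - 2 * j) * / ((- 4) ^ j))
        (Nat.div n 2).

(* For n = 0 the index [n - 1] truncates to 0, but the factor n annihilates
   that term. *)
Definition hermite_hat (n : nat) (x b : C) : C :=
  (b ^ 2 - 2 * INR n) * hermite n x
  - (b * hermite n x + INR n * hermite (n - 1) x) / (x + b).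

Definition Psi (x z : C) : C := Cexp (x * z - z ^ 2 / 4).

Definition Psi_hat (x z b : C) : C :=
  (z ^ 2 - 2 * z * x + b ^ 2 - (z + b) / (x + b)) * Psi x z.

(* Main.v *)
(** With [c_n = h_n(x) z^n / n!], the three-term recurrence of the Hermite
    polynomials reads [(n+1) c_(n+1) = x z c_n - (z^2/2) c_(n-1)]. Hence
    [y(t) = sum c_n t^n] is an entire solution of [y' = (x z - z^2 t / 2) y],
    [y(0) = 1], which gives [sum c_n = y(1) = Psi(x, z)]. Summing the recurrence
    once more gives [sum n c_n = (x z - z^2/2) Psi(x, z)], and the series of the
    [hermite_hat n] is a linear combination of [sum c_n], [sum n c_n] and
    [sum c_(n-1)]. *)

Require Import Defs.
From Stdlib Require Import Arith Lra Lia.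

(** * Complex series and power series of infinite radius *)

Lemma is_series_C (c : nat -> C) (l : C) :
  is_series (fun n => Re (c n)) (Re l) ->
  is_series (fun n => Im (c n)) (Im l) -> is_series c l.
Proof.
  intros Hre Him. apply filterlim_locally; intros eps.
  assert (H1 := proj1 (filterlim_locally _ _) Hre eps).
  assert (H2 := proj1 (filterlim_locally _ _) Him eps).
  assert (E1 : forall n, Re (sum_n c n) = sum_n (fun n => Re (c n)) n).
  { induction n; [now rewrite !sum_O | rewrite !sum_Sn, <- IHn; reflexivity]. }
  assert (E2 : forall n, Im (sum_n c n) = sum_n (fun n => Im (c n)) n).
  { induction n; [now rewrite !sum_O | rewrite !sum_Sn, <- IHn; reflexivity]. }
  generalize (filter_and _ _ H1 H2); apply filter_imp.
  intros n [B1 B2]; rewrite <- E1 in B1; rewrite <- E2 in B2.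
  (* A ball of [C] is the product of two real balls of the same radius. *)
  split; assumption.
Qed.

(** From index [N] on, the maximum of two consecutive values never increases, so a bound for the
    values up to [S N] bounds them all. *)
Lemma bounded_of_eventually_le_max (u : nat -> R) (N : nat) :
  (forall n, (N <= n)%nat -> u (S (S n)) <= Rmax (u n) (u (S n))) ->
  exists M, forall n, u n <= M.
Proof.
  intros Hu.
  assert (Hfin : forall k, exists M, forall n, (n <= k)%nat -> u n <= M).
  { induction k as [|k [M HM]].
    - exists (u O); intros n Hn; replace n with O by lia; lra.
    - exists (Rmax M (u (S k))); intros n Hn.
      destruct (Nat.eq_dec n (S k)) as [->|Hk]; [apply Rmax_r|].
      apply Rle_trans with M; [apply HM; lia | apply Rmax_l]. }
  destruct (Hfin (S N)) as [M HM]; exists M.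
  assert (Htail : forall k, u (N + k)%nat <= M /\ u (S (N + k)) <= M).
  { induction k as [|k [I1 I2]].
    - split; apply HM; lia.
    - rewrite Nat.add_succ_r; split; [exact I2|].
      apply Rle_trans with (1 := Hu _ (Nat.le_add_r _ _)).
      now apply Rmax_lub. }
  intros n; destruct (le_dec n N) as [Hn|Hn]; [apply HM; lia|].
  replace n with (N + (n - N))%nat by lia; apply Htail.
Qed.

Lemma CV_radius_infinite (a : nat -> R) :
  (forall r, exists M, forall n, Rabs (a n * r ^ n) <= M) ->
  CV_radius a = p_infty.
Proof.
  intros H. destruct (CV_radius_bounded a) as [Hub _].
  apply Rbar_le_antisym; [destruct (CV_radius a); exact I|].
  destruct (CV_radius a) as [r| |]; [|exact I|].
  (* The radius is an upper bound of all [r] with bounded terms; a finite radius fails at [r + 1],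
     and minus infinity fails at [0]. *)
  - specialize (Hub (r + 1)%R (H _)); simpl in Hub; lra.
  - exact (Hub 0%R (H _)).
Qed.

Lemma is_series_PSeries_1 (a : nat -> R) :
  CV_radius a = p_infty -> is_series a (PSeries a 1).
Proof.
  intros Ha.
  apply (is_series_ext (fun n => a n * 1 ^ n)%R).
  { intros n; rewrite pow1; apply Rmult_1_r. }
  apply (proj1 (is_pseries_R _ _ _)).
  apply PSeries_correct, CV_radius_inside; rewrite Ha; exact I.
Qed.

(** * Power series solution of y' = (A + B t) y *)

Lemma recurrence_bounded (A B : C) (c : nat -> C) (r : R) :
  (forall n, INR (S n) * c (S n) = A * c n + B * PS_incr_1 c n) ->
  exists M, forall n, Cmod (c n * r ^ n) <= M.
Proof.
  intros Hc.
  (* After multiplication by r^(n+2), the recurrence bounds n + 2 times the new term by |A r| + |B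
     r^2| times the maximum of the two previous ones. Once n + 2 exceeds this constant, the new term
     is at most that maximum. *)
  destruct (INR_unbounded (Cmod (A * r) + Cmod (B * r ^ 2))) as [N HN].
  apply bounded_of_eventually_le_max with N; intros n Hn.
  set (m := Rmax _ _).
  assert (Hpos : 0 < INR (S (S n))) by (apply lt_0_INR; lia).
  assert (HNn : INR N <= INR (S (S n))) by (apply le_INR; lia).
  apply Rmult_le_reg_l with (1 := Hpos).
  assert (E : INR (S (S n)) * (c (S (S n)) * r ^ (S (S n)))
          = (A * r) * (c (S n) * r ^ (S n)) + (B * r ^ 2) * (c n * r ^ n)).
  { rewrite Cmult_assoc, Hc; simpl; ring. }
  apply (f_equal Cmod) in E.
  rewrite Cmod_mult, Cmod_R, Rabs_pos_eq in E by lra.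
  rewrite E; clear E.
  eapply Rle_trans; [apply Cmod_triangle|].
  rewrite (Cmod_mult (A * r)), (Cmod_mult (B * r ^ 2)).
  assert (Hm0 := Rmax_l _ _ : Cmod (c n * r ^ n) <= m).
  assert (Hm1 := Rmax_r _ _ : Cmod (c (S n) * r ^ (S n)) <= m).
  pose proof (Cmod_ge_0 (A * r)). pose proof (Cmod_ge_0 (B * r ^ 2)).
  pose proof (Cmod_ge_0 (c n * r ^ n)).
  apply Rle_trans with ((Cmod (A * r) + Cmod (B * r ^ 2)) * m)%R.
  - rewrite Rmult_plus_distr_r.
    apply Rplus_le_compat; apply Rmult_le_compat_l; assumption.
  - apply Rmult_le_compat_r; lra.
Qed.

(** [PS_incr_1] is multiplication by t and [PS_derive] is differentiation, so the recurrence is the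
    differential equation read off coefficientwise. The sequences [a] and [b] will be the real and
    imaginary parts of one complex sequence, in either order. *)
Lemma is_derive_PSeries_recurrence (a b : nat -> R) (p q u v t : R) :
  CV_radius a = p_infty -> CV_radius b = p_infty ->
  (forall n, INR (S n) * a (S n)
     = p * a n + q * b n + u * PS_incr_1 a n + v * PS_incr_1 b n)%R ->
  is_derive (PSeries a) t
    ((p + u * t) * PSeries a t + (q + v * t) * PSeries b t)%R.
Proof.
  intros Ha Hb Hrec.
  assert (Pa : is_pseries a t (PSeries a t)).
  { apply PSeries_correct, CV_radius_inside; rewrite Ha; exact I. }
  assert (Pb : is_pseries b t (PSeries b t)).
  { apply PSeries_correct, CV_radius_inside; rewrite Hb; exact I. }
  replace (_ + _)%R with (PSeries (PS_derive a) t).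
  { apply is_derive_PSeries; rewrite Ha; exact I. }
  apply is_pseries_unique.
  assert (comm : forall s, mult t s = mult s t) by (intros; apply Rmult_comm).
  pose proof (is_pseries_plus _ _ _ _ _
    (is_pseries_plus _ _ _ _ _
      (is_pseries_scal p _ _ _ (comm p) Pa)
      (is_pseries_scal q _ _ _ (comm q) Pb))
    (is_pseries_plus _ _ _ _ _
      (is_pseries_scal u _ _ _ (comm u) (is_pseries_incr_1 _ _ _ Pa))
      (is_pseries_scal v _ _ _ (comm v) (is_pseries_incr_1 _ _ _ Pb)))) as P.
  apply (is_pseries_ext _ (PS_derive a)) in P.
  - replace (_ + _)%R with
      ((p * PSeries a t + q * PSeries b t)
       + (u * (t * PSeries a t) + v * (t * PSeries b t)))%R by ring.
    exact P.
  - intros n; unfold PS_derive; rewrite Hrec.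
    unfold PS_plus, PS_scal, plus, scal; simpl; unfold mult; simpl; ring.
Qed.

(* The power series y(t) with coefficients c solves y' = (A + B t) y with
   y(0) = 1, so the derivative of y(t) exp (- (A t + B t^2 / 2)) vanishes. *)
Lemma is_series_exp_quadratic (A B : C) (c : nat -> C) :
  c 0%nat = 1 ->
  (forall n, INR (S n) * c (S n) = A * c n + B * PS_incr_1 c n) ->
  is_series c (Cexp (A + B / 2)).
Proof.
  intros c0 Hc.
  set (a := fun n => Re (c n)); set (b := fun n => Im (c n)).
  assert (Ra : CV_radius a = p_infty).
  { apply CV_radius_infinite; intros r.
    destruct (recurrence_bounded A B c r Hc) as [M HM]; exists M; intros n.
    unfold a; rewrite <- re_scal_r, RtoC_pow.
    apply Rle_trans with (2 := HM n), re_le_Cmod. }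
  assert (Rb : CV_radius b = p_infty).
  { apply CV_radius_infinite; intros r.
    destruct (recurrence_bounded A B c r Hc) as [M HM]; exists M; intros n.
    unfold b; rewrite <- im_scal_r, RtoC_pow.
    apply Rle_trans with (2 := HM n).
    apply Rle_trans with (2 := Rmax_Cmod _), Rmax_r. }
  destruct A as [A1 A2], B as [B1 B2].
  assert (Da : forall t, is_derive (PSeries a) t
    ((A1 + B1 * t) * PSeries a t + (- A2 + - B2 * t) * PSeries b t)%R).
  { intros t; apply is_derive_PSeries_recurrence; trivial; intros n.
    unfold a at 1; rewrite <- re_scal_l, Hc.
    destruct n; unfold a, b, Re, Im, PS_incr_1, zero; simpl; ring. }
  assert (Db : forall t, is_derive (PSeries b) t
    ((A1 + B1 * t) * PSeries b t + (A2 + B2 * t) * PSeries a t)%R).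
  { intros t; apply is_derive_PSeries_recurrence; trivial; intros n.
    unfold b at 1; rewrite <- im_scal_l, Hc.
    destruct n; unfold a, b, Re, Im, PS_incr_1, zero; simpl; ring. }
  (* Real and imaginary parts of A t + B t^2 / 2. *)
  set (p := fun t : R => (A1 * t + B1 * t ^ 2 / 2)%R).
  set (q := fun t : R => (A2 * t + B2 * t ^ 2 / 2)%R).
  (* [EF] and [EG] are the real and imaginary parts of y(t) exp(-(p + i q)) at t = 1. Both functions
     have zero derivative, so they keep their values 1 and 0 from t = 0. *)
  assert (EF : 1%R = (exp (- p 1) *
    (cos (q 1) * PSeries a 1 + sin (q 1) * PSeries b 1))%R).
  { transitivity (exp (- p 0) *
      (cos (q 0) * PSeries a 0 + sin (q 0) * PSeries b 0))%R.
    - rewrite !PSeries_0; unfold p, q, a, b; rewrite c0; simpl.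
      replace (- _)%R with 0%R by field; replace (A2 * 0 + _)%R with 0%R by field.
      rewrite exp_0, cos_0, sin_0; ring.
    - apply (eq_is_derive (fun t => exp (- p t) *
        (cos (q t) * PSeries a t + sin (q t) * PSeries b t))%R 0 1); [|lra].
      intros t _; unfold p, q; auto_derive.
      + repeat split; eexists; [apply Da|apply Db].
      + rewrite (is_derive_unique _ _ _ (Da t) : Derive (fun x => PSeries a x) t = _).
        rewrite (is_derive_unique _ _ _ (Db t) : Derive (fun x => PSeries b x) t = _).
        unfold zero; simpl. field. }
  assert (EG : 0%R = (exp (- p 1) *
    (cos (q 1) * PSeries b 1 - sin (q 1) * PSeries a 1))%R).
  { transitivity (exp (- p 0) *
      (cos (q 0) * PSeries b 0 - sin (q 0) * PSeries a 0))%R.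
    - rewrite !PSeries_0; unfold p, q, a, b; rewrite c0; simpl.
      replace (- (A1 * _ + _))%R with 0%R by field;
      replace (A2 * 0 + _)%R with 0%R by field.
      rewrite exp_0, cos_0, sin_0; ring.
    - apply (eq_is_derive (fun t => exp (- p t) *
        (cos (q t) * PSeries b t - sin (q t) * PSeries a t))%R 0 1); [|lra].
      intros t _; unfold p, q; auto_derive.
      + repeat split; eexists; [apply Db|apply Da].
      + rewrite (is_derive_unique _ _ _ (Da t) : Derive (fun x => PSeries a x) t = _).
        rewrite (is_derive_unique _ _ _ (Db t) : Derive (fun x => PSeries b x) t = _).
        unfold zero; simpl. field. }
  rewrite exp_Ropp in EF, EG.
  pose proof (exp_pos (p 1)%R) as Hexp.
  assert (EF' : exp (p 1) = (cos (q 1) * PSeries a 1 + sin (q 1) * PSeries b 1)%R).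
  { apply (f_equal (Rmult (exp (p 1)))) in EF.
    rewrite <- Rmult_assoc, Rinv_r in EF; lra. }
  assert (EG' : 0%R = (cos (q 1) * PSeries b 1 - sin (q 1) * PSeries a 1)%R).
  { apply (f_equal (Rmult (exp (p 1)))) in EG.
    rewrite <- Rmult_assoc, Rinv_r in EG; lra. }
  pose proof (sin2_cos2 (q 1)%R) as Hsc; unfold Rsqr in Hsc.
  assert (Ep : Re ((A1, A2) + (B1, B2) / 2) = p 1%R).
  { unfold p, Re; simpl; field. }
  assert (Eq : Im ((A1, A2) + (B1, B2) / 2) = q 1%R).
  { unfold q, Im; simpl; field. }
  apply is_series_C; unfold Cexp; rewrite Ep, Eq; simpl.
  (* The rotation by angle [q 1] is undone by means of sin^2 + cos^2 = 1. *)
  - replace (_ * _)%R with (PSeries a 1).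
    + now apply is_series_PSeries_1.
    + transitivity ((sin (q 1) * sin (q 1) + cos (q 1) * cos (q 1)) * PSeries a 1
        + sin (q 1) * (cos (q 1) * PSeries b 1 - sin (q 1) * PSeries a 1))%R.
      * rewrite Hsc, <- EG'; ring.
      * rewrite EF'; ring.
  - replace (_ * _)%R with (PSeries b 1).
    + now apply is_series_PSeries_1.
    + transitivity ((sin (q 1) * sin (q 1) + cos (q 1) * cos (q 1)) * PSeries b 1
        - cos (q 1) * (cos (q 1) * PSeries b 1 - sin (q 1) * PSeries a 1))%R.
      * rewrite Hsc, <- EG'; ring.
      * rewrite EF'; ring.
Qed.

(** * Three-term recurrence of the Hermite polynomials *)

(* Vanishing beyond j = n/2 makes the range of summation irrelevant. *)
Definition hermite_term (n : nat) (x : C) (j : nat) : C :=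
  if (2 * j <=? n)%nat then
    INR (fact n) / (INR (fact (n - 2 * j)) * INR (fact j))
      * x ^ (n - 2 * j) * / ((- 4) ^ j)
  else 0.

Lemma hermite_eq_sum (n N : nat) (x : C) :
  (Nat.div n 2 <= N)%nat -> hermite n x = sum_n (hermite_term n x) N.
Proof.
  induction 1 as [|N HN IH].
  - apply sum_n_ext_loc; intros j Hj; unfold hermite_term.
    destruct (Nat.leb_spec (2 * j) n) as [|H]; [reflexivity|].
    pose proof (Nat.Div0.mul_div_le n 2); lia.
  - rewrite sum_Sn, <- IH; unfold hermite_term.
    destruct (Nat.leb_spec (2 * S N) n) as [H|_].
    + apply (Nat.div_le_lower_bound n 2) in H; lia.
    + symmetry; apply Cplus_0_r.
Qed.

Lemma INR_fact_neq_0_C (n : nat) : RtoC (INR (fact n)) <> 0.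
Proof. intros H; apply (INR_fact_neq_0 n), RtoC_inj, H. Qed.

Lemma INR_fact_S_C (n : nat) :
  RtoC (INR (fact (S n))) = (INR n + 1) * INR (fact n).
Proof. rewrite fact_simpl, mult_INR, S_INR, RtoC_mult, RtoC_plus; reflexivity. Qed.

Lemma INR_S_neq_0_C (n : nat) : RtoC (INR n) + 1 <> 0.
Proof.
  rewrite <- RtoC_plus, <- S_INR; intros H; apply RtoC_inj in H.
  now apply (not_0_INR (S n)).
Qed.

Lemma hermite_term_0 (n : nat) (x : C) : hermite_term n x 0 = x ^ n.
Proof.
  unfold hermite_term; simpl; rewrite Nat.sub_0_r.
  field; apply INR_fact_neq_0_C.
Qed.

(** All three terms carry the power x^(n-2j); after removal of the common factor the identity is n +
    2 = (n - 2j) + 2(j + 1). *)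
Lemma hermite_term_rec (n j : nat) (x : C) :
  hermite_term (S (S n)) x (S j)
  = x * hermite_term (S n) x (S j) - (INR n + 1) / 2 * hermite_term n x j.
Proof.
  pose proof (INR_fact_neq_0_C n) as Fn; pose proof (INR_fact_neq_0_C j) as Fj.
  pose proof (INR_S_neq_0_C j) as Sj.
  assert (F4 : (- 4) ^ j <> 0).
  { apply Cpow_nz; intros H; apply RtoC_inj in H; lra. }
  unfold hermite_term.
  destruct (Nat.leb_spec (2 * j) n) as [H|H].
  - destruct (Nat.leb_spec (2 * S j) (S (S n))) as [_|]; [|lia].
    replace (S (S n) - 2 * S j)%nat with (n - 2 * j)%nat by lia.
    destruct (Nat.leb_spec (2 * S j) (S n)) as [H'|H'].
    + replace (S n - 2 * S j)%nat with (n - 2 * j - 1)%nat by lia.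
      remember (n - 2 * j - 1)%nat as m eqn:Em.
      replace (n - 2 * j)%nat with (S m) by lia.
      pose proof (INR_fact_neq_0_C m) as Fm; pose proof (INR_S_neq_0_C m) as Sm.
      assert (E : RtoC (INR n) = INR m + 1 + 2 * INR j).
      { replace n with (m + 1 + 2 * j)%nat by lia.
        rewrite !plus_INR, mult_INR, !RtoC_plus, RtoC_mult; reflexivity. }
      rewrite !INR_fact_S_C, S_INR, RtoC_plus, !Cpow_S, E. field. repeat split; trivial.
    (* Here n = 2j: the term of degree n + 1 takes its default value 0, and the other two are
       constant in x. *)
    + replace (n - 2 * j)%nat with O by lia.
      assert (E : RtoC (INR n) = 2 * INR j).
      { replace n with (2 * j)%nat by lia.
        rewrite mult_INR, RtoC_mult; reflexivity. }
      rewrite !INR_fact_S_C, S_INR, RtoC_plus, Cpow_S, E.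
      simpl (fact 0); simpl (INR 1). field. repeat split; trivial.
  - destruct (Nat.leb_spec (2 * S j) (S (S n))) as [|_]; [lia|].
    destruct (Nat.leb_spec (2 * S j) (S n)) as [|_]; [lia|].
    ring.
Qed.

Lemma hermite_0 (x : C) : hermite 0 x = 1.
Proof.
  rewrite (hermite_eq_sum 0 0 x) by (simpl; lia).
  rewrite sum_O, hermite_term_0; reflexivity.
Qed.

Lemma hermite_1 (x : C) : hermite 1 x = x.
Proof.
  rewrite (hermite_eq_sum 1 0 x) by (simpl; lia).
  rewrite sum_O, hermite_term_0; simpl; ring.
Qed.

Lemma hermite_SS (n : nat) (x : C) :
  hermite (S (S n)) x = x * hermite (S n) x - (INR n + 1) / 2 * hermite n x.
Proof.
  rewrite (hermite_eq_sum (S (S n)) (S n)), (hermite_eq_sum (S n) (S n)),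
    (hermite_eq_sum n n) by (apply Nat.Div0.div_le_upper_bound; lia).
  (* Only the summation bounds are generalized, so the induction on [N] keeps the degree fixed. The
     bound on the right is one lower because index j + 1 is paired with j; the unpaired index 0
     gives x^(n+2) = x x^(n+1). *)
  generalize n at 2 4 7; intros N.
  induction N as [|N IH].
  - rewrite !sum_Sn, !sum_O, hermite_term_rec, !hermite_term_0, !Cpow_S.
    change (@plus C_AbelianMonoid) with Cplus; ring.
  - rewrite sum_Sn, IH, hermite_term_rec.
    rewrite (sum_Sn _ (S N)), (sum_Sn (hermite_term n x) N).
    change (@plus C_AbelianMonoid) with Cplus; ring.
Qed.

(** * Generating functions *)

Lemma hermite_exp_coef_rec (x z : C) (n : nat) :
  let c := fun n => hermite n x * (z ^ n / INR (fact n)) in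
  INR (S n) * c (S n) = (x * z) * c n + - (z ^ 2 / 2) * PS_incr_1 c n.
Proof.
  intros c; unfold c; destruct n as [|n].
  (* The shifted sequence starts with 0, so only h_1 = x h_0 remains. *)
  - simpl; rewrite hermite_0, hermite_1.
    change (@zero _) with (RtoC 0); field.
  - simpl PS_incr_1; rewrite hermite_SS, !INR_fact_S_C, !S_INR, !RtoC_plus, !Cpow_S.
    pose proof (INR_fact_neq_0_C n); pose proof (INR_S_neq_0_C n).
    pose proof (INR_S_neq_0_C (S n)) as HS; rewrite S_INR, RtoC_plus in HS.
    field; repeat split; trivial.
Qed.

Lemma is_series_hermite (x z : C) :
  is_series (fun n => hermite n x * (z ^ n / INR (fact n))) (Psi x z).
Proof.
  unfold Psi; replace (x * z - z ^ 2 / 4) with (x * z + - (z ^ 2 / 2) / 2) by field.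
  (* Here A = x z and B = -z^2/2. *)
  apply is_series_exp_quadratic.
  - rewrite hermite_0; simpl; field.
  - exact (hermite_exp_coef_rec x z).
Qed.

Lemma is_series_PS_incr_1 (c : nat -> C) (l : C) :
  is_series c l -> is_series (PS_incr_1 c) l.
Proof.
  intros H; apply is_series_decr_1.
  replace (plus _ _) with l; [exact H|].
  change (l = l + - 0); ring.
Qed.

Lemma is_series_Cplus (c d : nat -> C) (l m : C) :
  is_series c l -> is_series d m -> is_series (fun n => c n + d n) (l + m).
Proof. exact (is_series_plus (V := C_NormedModule) c d l m). Qed.

Lemma is_series_Cmult_l (a : C) (c : nat -> C) (l : C) :
  is_series c l -> is_series (fun n => a * c n) (a * l).
Proof. exact (is_series_scal (V := C_NormedModule) a c l). Qed.

Theorem proposition2p1 (b x z : C) (hx : x <> - b) :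
  is_series (fun n : nat => hermite_hat n x b * (z ^ n / INR (fact n)))
            (Psi_hat x z b).
Proof.
  assert (hxb : x + b <> 0).
  { intros H; apply hx; replace x with (x + b - b) by ring; rewrite H; ring. }
  pose proof (is_series_hermite x z) as Hc.
  pose proof (hermite_exp_coef_rec x z) as Hrec; cbv zeta in Hrec.
  set (c := fun n => hermite n x * (z ^ n / INR (fact n))) in *.
  pose proof (is_series_PS_incr_1 _ _ Hc) as Hi.
  assert (Hn : is_series (fun n => INR n * c n) ((x * z - z ^ 2 / 2) * Psi x z)).
  (* The term n = 0 vanishes; dropping it leaves (n+1) c_(n+1), which the recurrence expands. *)
  { apply is_series_decr_1.
    apply (is_series_ext (fun n => x * z * c n + - (z ^ 2 / 2) * PS_incr_1 c n)).
    { intros n; symmetry; exact (Hrec n). }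
    replace (plus _ _) with (x * z * Psi x z + - (z ^ 2 / 2) * Psi x z).
    { exact (is_series_Cplus _ _ _ _ (is_series_Cmult_l _ _ _ Hc)
               (is_series_Cmult_l _ _ _ Hi)). }
    change (x * z * Psi x z + - (z ^ 2 / 2) * Psi x z
      = (x * z - z ^ 2 / 2) * Psi x z + - (0 * c 0%nat)); ring. }
  (* The last summand comes from n h_(n-1) z^n / n! = z c_(n-1), with c_(-1) = 0 supplied by
     [PS_incr_1]. *)
  assert (Hhat : forall n, (b ^ 2 - b / (x + b)) * c n
      + (-2 * (INR n * c n) + - (z / (x + b)) * PS_incr_1 c n)
      = hermite_hat n x b * (z ^ n / INR (fact n))).
  { intros n.
    unfold hermite_hat, c; destruct n as [|n]; simpl PS_incr_1.
    - change (@zero _) with (RtoC 0); simpl; field; exact hxb.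
    - rewrite Nat.sub_succ, Nat.sub_0_r, INR_fact_S_C, S_INR, RtoC_plus, (Cpow_S z).
      pose proof (INR_fact_neq_0_C n); pose proof (INR_S_neq_0_C n).
      field; repeat split; trivial. }
  apply (is_series_ext _ _ _ Hhat).
  replace (Psi_hat x z b) with ((b ^ 2 - b / (x + b)) * Psi x z
    + (-2 * ((x * z - z ^ 2 / 2) * Psi x z) + - (z / (x + b)) * Psi x z)).
  { exact (is_series_Cplus _ _ _ _ (is_series_Cmult_l _ _ _ Hc)
      (is_series_Cplus _ _ _ _ (is_series_Cmult_l _ _ _ Hn)
        (is_series_Cmult_l _ _ _ Hi))). }
  unfold Psi_hat; field; exact hxb.
Qed.
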